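(* Let $\mathbf{A}\in\mathbb{R}^{m\times n}$, $\boldsymbol{b}\in\mathbb{R}^m$, and $f(\boldsymbol{x})=\tfrac12\|\mathbf{A}\boldsymbol{x}-\boldsymbol{b}\|_2^2$ for $\boldsymbol{x}\in\mathbb{R}^n$. Let $\mathbf{W}\in\mathbb{R}^{n\times n}$ be symmetric with $\sigma(\mathbf{W})\subset[0,1]$ and $\ker(\mathbf{A})\cap\mathrm{fix}(\mathbf{W})=\{\mathbf{0}\}$. Let $\{\alpha_k\}_{k\geqslant1}$ be a sequence of real numbers with $\lim_{k\to\infty}\alpha_k=1$. Then: (i) For every $\gamma\in(0,1/\lambda_{\max}(\mathbf{A}^\top\mathbf{A}))$, the iterates $\{\boldsymbol{x}_k\}$ of $\alpha$-PnP-FISTA (with loss $f$, denoiser $\mathbf{W}$, step size $\gamma$ and momentum parameters $\{\alpha_k\}$) exhibit global linear convergence. (ii) For every $L\geqslant1$ and $\lambda>0$, the iterates $\{\boldsymbol{x}_k\}$ of $\alpha$-RED-APG (with loss $f$, denoiser $\mathbf{W}$, parameters $\lambda,L$ and momentum parameters $\{\alpha_k\}$) exhibit global linear convergence.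
   Context: Notation: $\sigma(\mathbf{W})$ is the spectrum of $\mathbf{W}$; $\mathrm{fix}(\mathbf{W})=\{\boldsymbol{x}:\mathbf{W}\boldsymbol{x}=\boldsymbol{x}\}$; $\ker(\mathbf{A})$ is the kernel; $\lambda_{\max}$ denotes the largest eigenvalue. The proximal operator of $\mu f$ is $\mathrm{prox}_{\mu f}(\boldsymbol{v})=\arg\min_{\boldsymbol{x}}\{\tfrac12\|\boldsymbol{x}-\boldsymbol{v}\|_2^2+\mu f(\boldsymbol{x})\}$. $\alpha$-PnP-FISTA: given an initialization $\boldsymbol{x}_0\in\mathbb{R}^n$, set $\boldsymbol{y}_1=\boldsymbol{x}_0$ and for $k\geqslant1$ iterate $$\boldsymbol{x}_k=\mathbf{W}\big(\boldsymbol{y}_k-\gamma\nabla f(\boldsymbol{y}_k)\big),\qquad \boldsymbol{y}_{k+1}=\boldsymbol{x}_k+\alpha_k(\boldsymbol{x}_k-\boldsymbol{x}_{k-1}).$$ $\alpha$-RED-APG: let $\theta=1/L$; given an initialization $\boldsymbol{v}_0\in\mathbb{R}^n$ (and $\boldsymbol{x}_0\in\mathbb{R}^n$), for $k\geqslant1$ iterate $$\boldsymbol{x}_k=\mathrm{prox}_{(\lambda L)^{-1}f}(\boldsymbol{v}_{k-1}),\qquad \boldsymbol{y}_k=\boldsymbol{x}_k+\alpha_k(\boldsymbol{x}_k-\boldsymbol{x}_{k-1}),\qquad \boldsymbol{v}_k=\theta\,\mathbf{W}\boldsymbol{y}_k+(1-\theta)\,\boldsymbol{y}_k.$$ A sequence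 $\{\boldsymbol{x}_k\}\subset\mathbb{R}^n$ converges linearly to $\boldsymbol{x}^*\in\mathbb{R}^n$ if there exist a norm $\|\cdot\|$ on $\mathbb{R}^n$, $K\geqslant1$, $C>0$ and $\beta\in[0,1)$ such that $\|\boldsymbol{x}_k-\boldsymbol{x}^*\|\leqslant C\beta^k$ for all $k\geqslant K$. The iterates of an algorithm exhibit global linear convergence if, for every initialization, the sequence of iterates converges linearly to some point. *)

(* Defs.v *)
From HB Require Import structures.
From mathcomp Require Import all_boot all_order all_algebra.
From mathcomp Require Import all_classical all_reals all_analysis.
Import Order.TTheory GRing.Theory Num.Theory.
Import numFieldNormedType.Exports.

Set Implicit Arguments.
Unset Strict Implicit.
Unset Printing Implicit Defensive.

Local Open Scope classical_set_scope.
Local Open Scope ring_scope.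

Section LinearAlgebra.
Variable R : realType.

Definition norm2 (n : nat) (v : 'cV[R]_n) : R :=
  Num.sqrt (\sum_i v i ord0 ^+ 2).

(* The real eigenvalues. This is the full spectrum for symmetric matrices,
   the only ones it is used for. *)
Definition spectrum (n : nat) (M : 'M[R]_n) : set R :=
  [set a | eigenvalue M a].

(* The spectrum is finite, so for n > 0 and M symmetric the supremum is a
   maximum; the value for n = 0 is sup set0 = 0. *)
Definition lambda_max (n : nat) (M : 'M[R]_n) : R := sup (spectrum M).

Definition null_space (m n : nat) (A : 'M[R]_(m, n)) : set 'cV[R]_n :=
  [set x | A *m x = 0].

Definition fix_space (n : nat) (W : 'M[R]_n) : set 'cV[R]_n :=
  [set x | W *m x = x].

End LinearAlgebra.

Section LossAndProx.
Variables (R : realType) (n : nat).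
Implicit Types (f : 'cV[R]_n -> R) (v x : 'cV[R]_n).

Definition least_squares (m : nat) (A : 'M[R]_(m, n)) (b : 'cV[R]_m) x : R :=
  2^-1 * norm2 (A *m x - b) ^+ 2.

Definition gradient f x : 'cV[R]_n := \col_i 'D_(delta_mx i ord0) f x.

Definition argmin f : set 'cV[R]_n := [set x | forall z, f x <= f z].

(* The minimizer exists and is unique for mu >= 0 and f convex and continuous;
   the default value 0 of xget is only reached when there is no minimizer. *)
Definition prox (mu : R) f v : 'cV[R]_n :=
  xget 0 (argmin (fun x => 2^-1 * norm2 (x - v) ^+ 2 + mu * f x)).

End LossAndProx.

Section Algorithms.
Variables (R : realType) (n : nat).
Implicit Types (f : 'cV[R]_n -> R) (W : 'M[R]_n) (alpha : nat -> R).

(* The pair (x_k, y_{k+1}). *)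
Fixpoint pnp_fista_state f W (gamma : R) alpha (x0 : 'cV[R]_n) (k : nat) :
    'cV[R]_n * 'cV[R]_n :=
  if k is j.+1 then
    let: (xj, yk) := pnp_fista_state f W gamma alpha x0 j in
    let xk := W *m (yk - gamma *: gradient f yk) in
    (xk, xk + alpha k *: (xk - xj))
  else (x0, x0).

Definition pnp_fista f W gamma alpha (x0 : 'cV[R]_n) (k : nat) : 'cV[R]_n :=
  (pnp_fista_state f W gamma alpha x0 k).1.

(* The pair (x_k, v_k), started at the pair (x_0, v_0). *)
Fixpoint red_apg_state f W (lambda L : R) alpha
    (init : 'cV[R]_n * 'cV[R]_n) (k : nat) : 'cV[R]_n * 'cV[R]_n :=
  if k is j.+1 then
    let: (xj, vj) := red_apg_state f W lambda L alpha init j in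
    let theta := 1 / L in
    let xk := prox (lambda * L)^-1 f vj in
    let yk := xk + alpha k *: (xk - xj) in
    (xk, theta *: (W *m yk) + (1 - theta) *: yk)
  else init.

Definition red_apg f W lambda L alpha (init : 'cV[R]_n * 'cV[R]_n) (k : nat) :
    'cV[R]_n :=
  (red_apg_state f W lambda L alpha init k).1.

End Algorithms.

Section LinearConvergence.
Variables (R : realType) (n : nat).

Definition is_norm (N : 'cV[R]_n -> R) : Prop :=
  [/\ forall x, 0 <= N x,
      forall x, N x = 0 -> x = 0,
      forall (a : R) x, N (a *: x) = `|a| * N x
    & forall x y, N (x + y) <= N x + N y].

Definition converges_linearly (x : nat -> 'cV[R]_n) (xstar : 'cV[R]_n) : Prop :=
  exists (N : 'cV[R]_n -> R) (K : nat) (C beta : R),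
    [/\ is_norm N, (1 <= K)%N, 0 < C, 0 <= beta < 1
      & forall k, (K <= k)%N -> N (x k - xstar) <= C * beta ^+ k].

Definition global_linear_convergence (Init : Type)
    (iterates : Init -> nat -> 'cV[R]_n) : Prop :=
  forall init, exists xstar, converges_linearly (iterates init) xstar.

End LinearConvergence.

(* Main.v *)
(* Both algorithms are momentum iterations
   [x_(k+1) = P (x_k + alpha_k (x_k - x_(k-1))) + q] with [P = W G], resp.
   [P = G W'], where [G] is [I - gamma A^T A], resp. [(I + mu A^T A)^-1], and
   [W'] is [theta W + (1 - theta) I].  In both cases [P] is similar to the
   symmetric matrix [H W H] (resp. [H W' H]) with [H = G^(1/2)], whose
   eigenvalues lie in [0, 1), the value 1 being excluded by the condition
   ker A /\ fix W = 0.  In an eigenbasis the iteration decouples into scalar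
   recurrences, each of which has an explicit quadratic Lyapunov function. *)

Require Import Defs.
From HB Require Import structures.
From mathcomp Require Import all_boot all_order all_algebra.
From mathcomp Require Import all_classical all_reals all_analysis.
From mathcomp Require Import ring lra complex.
Import Order.TTheory GRing.Theory Num.Theory.
Import numFieldNormedType.Exports.

Set Implicit Arguments.
Unset Strict Implicit.
Unset Printing Implicit Defensive.

Local Open Scope classical_set_scope.
Local Open Scope ring_scope.

(** * Euclidean inner product and a Householder reflection *)

Section Dot.
Context {R : realFieldType}.

Definition dot (n : nat) (x y : 'cV[R]_n) : R := (x^T *m y) 0 0.

Lemma dotE n (x y : 'cV[R]_n) : dot x y = \sum_i x i 0 * y i 0.
Proof. by rewrite /dot mxE; apply: eq_bigr => i _; rewrite mxE. Qed.

Lemma dotC n (x y : 'cV[R]_n) : dot x y = dot y x.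
Proof. by rewrite !dotE; apply: eq_bigr => i _; rewrite mulrC. Qed.

Lemma dotDr n (x y z : 'cV[R]_n) : dot x (y + z) = dot x y + dot x z.
Proof. by rewrite /dot mulmxDr mxE. Qed.

Lemma dotZr n a (x y : 'cV[R]_n) : dot x (a *: y) = a * dot x y.
Proof. by rewrite /dot -scalemxAr mxE. Qed.

Lemma dotNr n (x y : 'cV[R]_n) : dot x (- y) = - dot x y.
Proof. by rewrite /dot mulmxN mxE. Qed.

Lemma dotDl n (x y z : 'cV[R]_n) : dot (y + z) x = dot y x + dot z x.
Proof. by rewrite dotC dotDr !(dotC x). Qed.

Lemma dotZl n a (x y : 'cV[R]_n) : dot (a *: y) x = a * dot y x.
Proof. by rewrite dotC dotZr dotC. Qed.

Lemma dotNl n (x y : 'cV[R]_n) : dot (- y) x = - dot y x.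
Proof. by rewrite dotC dotNr dotC. Qed.

Definition dot_linear := (@dotDl, @dotDr, @dotZl, @dotZr, @dotNl, @dotNr).

Lemma dot_mulmxl m n (M : 'M[R]_(m, n)) x y : dot (M *m x) y = dot x (M^T *m y).
Proof. by rewrite /dot trmx_mul mulmxA. Qed.

Lemma dotxx_ge0 n (x : 'cV[R]_n) : 0 <= dot x x.
Proof. by rewrite dotE sumr_ge0 // => i _; rewrite -expr2 sqr_ge0. Qed.

Lemma dotxx_eq0 n (x : 'cV[R]_n) : (dot x x == 0) = (x == 0).
Proof.
apply/idP/idP => [|/eqP ->]; last by rewrite /dot mulmx0 mxE.
rewrite dotE psumr_eq0 => [/allP x0|i _]; last by rewrite -expr2 sqr_ge0.
apply/eqP/colP => i; rewrite mxE; apply/eqP.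
by have := x0 i (mem_index_enum i); rewrite mulf_eq0 orbb.
Qed.

Lemma dotxx_gt0 n (x : 'cV[R]_n) : x != 0 -> 0 < dot x x.
Proof. by move=> x0; rewrite lt0r dotxx_ge0 dotxx_eq0 x0. Qed.

(** The inner product of [x] with [A^T A x] is the squared length of [A x]. *)
Lemma mul_tr_mx_eq0 m n (A : 'M[R]_(m, n)) (x : 'cV[R]_n) :
  A^T *m (A *m x) = 0 -> A *m x = 0.
Proof.
by move=> AAx; apply/eqP; rewrite -dotxx_eq0 dot_mulmxl AAx /dot mulmx0 mxE.
Qed.

(* [H] is the Householder reflection exchanging [u] and [e_0]. *)
Lemma orthogonal_with_first_row n (u : 'cV[R]_n.+1) : dot u u = 1 ->
  exists2 H : 'M[R]_n.+1, H *m H^T = 1%:M & delta_mx 0 0 *m H = u^T.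
Proof.
move=> uu1; set e : 'cV[R]_n.+1 := delta_mx 0 0.
pose w := u - e; pose s := dot w w.
have ee : dot e e = 1.
  by rewrite /dot /e trmx_delta mul_delta_mx mxE !eqxx.
have sE : s = 2 - 2 * dot e u.
  by rewrite /s /w !dot_linear (dotC u e) uu1 ee; ring.
have scE (a : 'M[R]_1) : a = (a 0 0)%:M by rewrite -mx11_scalar.
pose H : 'M[R]_n.+1 := 1%:M - (2 / s) *: (w *m w^T).
have Hsym : H^T = H.
  by rewrite /H linearB linearZ /= trmx1 trmx_mul trmxK.
have e0E : delta_mx 0 0 = e^T :> 'rV[R]_n.+1 by rewrite trmx_delta.
(* If [u] is already [e], then [s = 0] and no reflection is defined; the identity serves instead. *)
have [w0|w0] := eqVneq w 0.
  exists 1%:M; first by rewrite trmx1 mulmx1.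
  by rewrite mulmx1 e0E; congr trmx; apply/esym/eqP; rewrite -subr_eq0 -/w w0.
have s0 : s != 0 by rewrite dotxx_eq0.
exists H.
  rewrite Hsym /H mulmxBl mul1mx mulmxBr mulmx1 -scalemxAl -scalemxAr.
  have -> : w *m w^T *m (w *m w^T) = s *: (w *m w^T).
    by rewrite mulmxA -(mulmxA w) [w^T *m w]scE mul_mx_scalar -scalemxAl.
  rewrite !scalerA opprB addrA addrAC -addrA.
  have -> : 2 / s * (2 / s) * s = 2 / s + 2 / s by field.
  by rewrite scalerDl; set z := _ *: _; rewrite addKr subrK.
rewrite e0E /H mulmxBr mulmx1 -scalemxAr mulmxA [e^T *m w]scE -/(dot e w).
rewrite mul_scalar_mx scalerA.
have -> : 2 / s * dot e w = -1.
  have -> : dot e w = - s / 2 by rewrite sE /w !dot_linear ee; field.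
  by field.
by rewrite scaleN1r opprK -linearD /= /w addrC subrK.
Qed.
End Dot.

(** * Spectral theorem for real symmetric matrices *)

Section Spectral.
Context {R : rcfType}.

(** Over [R[i]] the matrix is Hermitian, hence diagonalizable with real eigenvalues. The eigenvector
    found is complex, but being an eigenvalue is invariant under field extension, so the value
    descends to [R]. *)
Lemma symmetric_eigenvalue n (S : 'M[R]_n.+1) : S^T = S ->
  exists a, eigenvalue S a.
Proof.
move=> Ssym; pose f : {rmorphism R -> R[i]} := real_complex R.
have Sherm : map_mx f S \is hermsymmx.
  apply: realsym_hermsym.
    apply/is_hermitianmxP; rewrite expr0 scale1r; apply/matrixP => i j.
    by rewrite !mxE /= -[in LHS]Ssym mxE.
  apply/mxOverP => i j; rewrite mxE; apply/complex_realP.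
  by exists (S i j).
have Snorm := hermitian_normalmx Sherm.
have /mxOverP/(_ 0 0) := hermitian_spectral_diag_real Sherm.
set z := spectral_diag _ 0 0 => /complex_realP [a za]; exists a.
have := orthomx_spectralP Snorm; set U := spectralmx _ => SE.
have Uu : U \in unitmx by exact: spectral_unit.
rewrite -(eigenvalue_map f) -/(f a); apply/eigenvalueP; exists (row 0 U).
  rewrite -row_mul {1}SE !mulmxA mulmxV // mul1mx row_mul.
  by rewrite row_diag_mx -scalemxAl -rowE -/z za.
by apply: contraTneq Uu => U0; rewrite -row_free_unit; apply/row_freePn;
   exists 0; rewrite U0 sub0mx.
Qed.

(** Deflation: conjugating by an orthogonal matrix whose first row is a unit eigenvector splits off
    a 1 by 1 block and leaves a smaller symmetric one for the induction. *)
Lemma symmetric_spectral n (S : 'M[R]_n) : S^T = S ->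
  exists (Q : 'M[R]_n) (d : 'rV[R]_n),
    Q *m Q^T = 1%:M /\ S = Q^T *m diag_mx d *m Q.
Proof.
elim: n S => [|n IHn] S Ssym.
  by exists 0, 0; split; apply/matrixP => -[].
have [a /eigenvalueP [v vS v0]] := symmetric_eigenvalue Ssym.
have vv : 0 < dot v^T v^T by apply: dotxx_gt0; rewrite trmx_eq0.
pose c := (Num.sqrt (dot v^T v^T))^-1; pose u := c *: v^T.
have uu : dot u u = 1.
  rewrite /u !dot_linear mulrA -expr2 exprVn sqr_sqrtr ?ltW //.
  by rewrite mulVf // gt_eqF.
have uS : u^T *m S = a *: u^T.
  by rewrite /u linearZ /= trmxK -scalemxAl vS !scalerA mulrC.
have [H HH He] := orthogonal_with_first_row uu.
(* [B] is typed at size [1 + n] for the block operations, and its body is kept opaque. *)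
have [B BH] : exists B : 'M[R]_(1 + n), B = H *m S *m H^T.
  by exists (H *m S *m H^T).
have Bsym : B^T = B by rewrite BH !trmx_mul trmxK Ssym mulmxA.
have B0 j : B 0 j = a * (j == 0)%:R.
  transitivity (((delta_mx 0 0 : 'rV[R]_(1 + n)) *m B) 0 j).
    by rewrite -rowE [RHS]mxE.
  rewrite BH !mulmxA He uS -scalemxAl -He -mulmxA HH mulmx1.
  by rewrite !mxE eqxx.
have Bur : ursubmx B = 0.
  by apply/matrixP => i j; rewrite !mxE (ord1 i) !lshift0 B0 /= mulr0.
have Bul : ulsubmx B = a%:M.
  by apply/matrixP => i j; rewrite !mxE !(ord1 i, ord1 j) !lshift0 B0 /= mulr1.
have Bdl : dlsubmx B = 0.
  by rewrite -[B]Bsym -trmx_ursub Bur trmx0.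
have [|Q [d [QQ BE]]] := IHn (drsubmx B).
  by rewrite trmx_drsub Bsym.
pose K : 'M[R]_(1 + n) := block_mx 1%:M 0 0 Q.
have KE : K^T *m diag_mx (row_mx a%:M d) *m K = B.
  rewrite -[B]submxK Bur Bul Bdl BE /K tr_block_mx diag_mx_row !mulmx_block.
  rewrite !(trmx0, trmx1, mulmx0, mul0mx, mulmx1, mul1mx, addr0, add0r).
  by congr block_mx; apply/matrixP => i j; rewrite !mxE !ord1.
have KK : K *m K^T = 1%:M.
  rewrite /K tr_block_mx mulmx_block.
  rewrite !(trmx0, trmx1, mulmx0, mul0mx, mulmx1, mul1mx, addr0, add0r) QQ.
  by rewrite -scalar_mx_block.
exists (K *m H), (row_mx a%:M d); split.
  by rewrite trmx_mul mulmxA -(mulmxA K) HH mulmx1 KK.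
transitivity (H^T *m B *m H); last by rewrite -KE trmx_mul !mulmxA.
have HtH : H^T *m H = 1%:M by exact: mulmx1C.
by rewrite BH -!mulmxA HtH mulmx1 mulmxA HtH mul1mx.
Qed.
End Spectral.

(** * Quadratic forms, square roots, and diagonalization of a product *)

Section QuadraticForms.
Context {R : rcfType} {n : nat}.
Implicit Types (S G W Q : 'M[R]_n) (d : 'rV[R]_n) (x : 'cV[R]_n).

Lemma dot_orthogonal Q x : Q *m Q^T = 1%:M -> dot (Q *m x) (Q *m x) = dot x x.
Proof. by move=> /mulmx1C QQ; rewrite dot_mulmxl mulmxA QQ mul1mx. Qed.

Lemma dot_spectral Q d x :
  dot x (Q^T *m diag_mx d *m Q *m x) = \sum_i d 0 i * (Q *m x) i 0 ^+ 2.
Proof.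
rewrite -!mulmxA dotC dot_mulmxl trmxK dotE.
by apply: eq_bigr => i _; rewrite mul_diag_mx [X in X * _]mxE expr2 mulrA.
Qed.

Lemma spectral_eigenvalue Q d i : Q *m Q^T = 1%:M ->
  eigenvalue (Q^T *m diag_mx d *m Q) (d 0 i).
Proof.
move=> QQ; apply/eigenvalueP; exists (row i Q).
  rewrite -row_mul !mulmxA QQ mul1mx row_mul row_diag_mx -scalemxAl -rowE //.
apply/eqP => Qi; have /matrixP/(_ i i) := QQ.
have -> : (Q *m Q^T) i i = (row i Q *m Q^T) 0 i by rewrite -row_mul [RHS]mxE.
by rewrite Qi mul0mx !mxE eqxx => /esym/eqP; rewrite oner_eq0.
Qed.

(** The witness is the [i]-th eigenvector. This turns bounds on the quadratic form into bounds on
    the diagonal entries. *)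
Lemma spectral_diag_dot Q d i : Q *m Q^T = 1%:M ->
  exists2 x, dot x x = 1 & dot x (Q^T *m diag_mx d *m Q *m x) = d 0 i.
Proof.
move=> QQ; exists (Q^T *m delta_mx i 0).
  rewrite -(dot_orthogonal _ QQ) mulmxA QQ mul1mx dotE (bigD1 i) //=.
  rewrite big1 ?addr0 ?mxE ?eqxx ?mulr1 // => j ji.
  by rewrite !mxE (negPf ji) mulr0.
rewrite dot_spectral mulmxA QQ mul1mx (bigD1 i) //=.
rewrite big1 ?addr0 ?mxE ?eqxx ?expr1n ?mulr1 // => j ji.
by rewrite !mxE (negPf ji) expr0n mulr0.
Qed.

Lemma dot_le_of_eigenvalue_le S c : S^T = S ->
  (forall a, eigenvalue S a -> a <= c) ->
  forall x, dot x (S *m x) <= c * dot x x.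
Proof.
move=> /symmetric_spectral [Q [d [QQ SE]]] Sc x.
rewrite SE dot_spectral -(dot_orthogonal x QQ) dotE mulr_sumr.
apply: ler_sum => i _; rewrite -expr2 ler_wpM2r ?sqr_ge0 // Sc // SE.
exact: spectral_eigenvalue.
Qed.

Lemma dot_ge0_of_eigenvalue_ge0 S : S^T = S ->
  (forall a, eigenvalue S a -> 0 <= a) -> forall x, 0 <= dot x (S *m x).
Proof.
move=> /symmetric_spectral [Q [d [QQ SE]]] Sc x.
rewrite SE dot_spectral sumr_ge0 // => i _.
rewrite mulr_ge0 ?sqr_ge0 // Sc // SE.
exact: spectral_eigenvalue.
Qed.

(** Equality case of the contraction bound: in eigencoordinates the nonnegative terms
    [(1 - d_i) y_i^2] sum to zero, so each [y_i] vanishes unless [d_i = 1]. *)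
Lemma contraction_fix S : S^T = S -> (forall x, dot x (S *m x) <= dot x x) ->
  forall x, dot x x <= dot x (S *m x) -> S *m x = x.
Proof.
move=> /symmetric_spectral [Q [d [QQ SE]]] S1 x xSx.
have d1 i : d 0 i <= 1.
  by have [y y1 <-] := spectral_diag_dot d i QQ; rewrite -SE -y1.
have : \sum_i (1 - d 0 i) * (Q *m x) i 0 ^+ 2 == 0.
  rewrite eq_le sumr_ge0 ?andbT => [|i _]; last first.
    by rewrite mulr_ge0 ?sqr_ge0 ?subr_ge0.
  under eq_bigr => i _ do rewrite mulrBl mul1r.
  rewrite sumrB -dot_spectral -SE subr_le0; apply: le_trans xSx.
  by rewrite -(dot_orthogonal x QQ) dotE; under eq_bigr => i _ do rewrite expr2.
rewrite psumr_eq0 => [/allP d0|i _]; last first.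
  by rewrite mulr_ge0 ?sqr_ge0 ?subr_ge0.
rewrite SE -!mulmxA; have -> : diag_mx d *m (Q *m x) = Q *m x.
  apply/colP => i; rewrite mul_diag_mx mxE; apply/eqP.
  have := d0 i (mem_index_enum i); rewrite mulf_eq0 subr_eq0 sqrf_eq0.
  by case/orP => /eqP; [move=> <-; rewrite mul1r|move=> ->; rewrite mulr0].
by rewrite mulmxA (mulmx1C QQ) mul1mx.
Qed.

Lemma positive_sqrtmx G : G^T = G -> (forall x, x != 0 -> 0 < dot x (G *m x)) ->
  exists H : 'M[R]_n, [/\ H^T = H, H \in unitmx & H *m H = G].
Proof.
move=> /symmetric_spectral [Q [d [QQ GE]]] Gpos.
have d0 i : 0 < d 0 i.
  have [y y1 <-] := spectral_diag_dot d i QQ; rewrite -GE Gpos //.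
  by rewrite -dotxx_eq0 y1 oner_eq0.
(* Functional calculus: [H f] applies [f] to the eigenvalues and is multiplicative in [f], so the
   root is [H Num.sqrt] and its inverse comes from the reciprocal root. *)
pose H (f : R -> R) := Q^T *m diag_mx (map_mx f d) *m Q.
have HM f g : H f *m H g = Q^T *m diag_mx (\row_i (f (d 0 i) * g (d 0 i))) *m Q.
  rewrite /H !mulmxA; congr (_ *m _); rewrite -!mulmxA; congr (_ *m _).
  rewrite (mulmxA Q) QQ mul1mx mulmx_diag; congr diag_mx.
  by apply/rowP => i; rewrite !mxE.
exists (H Num.sqrt); split.
- by rewrite /H !trmx_mul trmxK tr_diag_mx mulmxA.
- apply: (mulmx1_unit (B := H (fun a => (Num.sqrt a)^-1)) _).1.
  rewrite HM (_ : \row_i _ = const_mx 1).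
    by rewrite diag_const_mx mulmx1 (mulmx1C QQ).
  by apply/rowP => i; rewrite !mxE divff // sqrtr_eq0 -ltNge.
- rewrite HM GE (_ : \row_i _ = d) //.
  by apply/rowP => i; rewrite !mxE -expr2 sqr_sqrtr // ltW.
Qed.

(** With [H] the square root of [G], conjugating [W G] by [H] gives [H (W G) H^-1 = H W H], which is
    symmetric; so [T] is [H] followed by an orthogonal eigenbasis change. *)
Lemma mulmx_diagonalizable W G :
    W^T = W -> (forall x, 0 <= dot x (W *m x) <= dot x x) ->
    G^T = G -> (forall x, x != 0 -> 0 < dot x (G *m x) <= dot x x) ->
    (forall x, W *m x = x -> G *m x = x -> x = 0) ->
  exists (T : 'M[R]_n) (d : 'rV[R]_n), [/\ T \in unitmx,
    forall i, 0 <= d 0 i < 1 & W *m G = invmx T *m diag_mx d *m T].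
Proof.
move=> Wsym W01 Gsym G01 fixWG.
have [|H [Hsym Hu HH]] := positive_sqrtmx Gsym.
  by move=> x /G01/andP[].
have Gle x : dot x (G *m x) <= dot x x.
  have [->|/G01/andP[]//] := eqVneq x 0.
  by rewrite mulmx0 /dot mulmx0 lexx.
pose M := H *m W *m H.
have Msym : M^T = M by rewrite /M !trmx_mul Hsym Wsym mulmxA.
have ME x : dot x (M *m x) = dot (H *m x) (W *m (H *m x)).
  by rewrite dot_mulmxl Hsym /M !mulmxA.
have HxE x : dot (H *m x) (H *m x) = dot x (G *m x).
  by rewrite dot_mulmxl Hsym mulmxA HH.
(* Otherwise [|x|^2 <= <Hx, W Hx> <= |Hx|^2 = <x, G x> <= |x|^2] collapses to equalities: [G] fixes
   [x] and [W] fixes [H x]. As [H] commutes with [G], both matrices fix [H x], which is therefore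
   zero. *)
have M1 x : x != 0 -> dot x (M *m x) < dot x x.
  move=> x0; rewrite ltNge; apply: contra_neqN x0 => xMx.
  have W1 y : dot y (W *m y) <= dot y y by case/andP: (W01 y).
  have Gx : G *m x = x.
    apply: contraction_fix => //; apply: le_trans xMx _.
    by rewrite ME -HxE.
  have WHx : W *m (H *m x) = H *m x.
    apply: contraction_fix => //; rewrite -ME HxE; apply: le_trans xMx.
    exact: Gle.
  have : H *m x = 0.
    apply: fixWG => //; by rewrite -HH -!mulmxA [H *m (H *m x)]mulmxA HH Gx.
  by move/(congr1 (mulmx (invmx H))); rewrite mulKmx // mulmx0.
have [Q [d [QQ MQ]]] := symmetric_spectral Msym.
exists (Q *m H), d; split.
- by rewrite unitmx_mul Hu (mulmx1_unit QQ).1.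
- move=> i; have [x x1 <-] := spectral_diag_dot d i QQ; rewrite -MQ.
  have x0 : x != 0 by rewrite -dotxx_eq0 x1 oner_eq0.
  by rewrite -[X in _ < X]x1 M1 // ME andbT; case/andP: (W01 (H *m x)).
- have Tu : Q *m H \in unitmx by rewrite unitmx_mul Hu (mulmx1_unit QQ).1.
  rewrite -mulmxA; apply: (canRL (mulKmx Tu)).
  have QM : diag_mx d *m Q = Q *m M by rewrite MQ !mulmxA QQ mul1mx.
  by rewrite [RHS]mulmxA QM /M -HH !mulmxA.
Qed.
End QuadraticForms.

(** * Scalar momentum recurrences and the vector iteration *)

Section Recurrence.
Context {R : realType}.
Implicit Types alpha : nat -> R.

(* The characteristic roots of the limiting recurrence (alpha = 1) are
   [l +- i sqrt (l - l^2)], of squared modulus [l]; for such a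
   root [t], the Lyapunov function of the proof is
   [|a_k - t a_(k-1)|^2 = (1 - l) a_k^2 + l (a_k - a_(k-1))^2]. *)
Lemma momentum_recurrence_decay (l : R) alpha (a : nat -> R) :
    0 <= l < 1 -> alpha k @[k --> \oo] --> (1 : R) ->
    (forall k, a k.+2 = l * (a k.+1 + alpha k.+1 * (a k.+1 - a k))) ->
  exists p : nat * R * R, [/\ 0 <= p.1.2, 0 <= p.2 < 1
    & forall k, (p.1.1 <= k)%N -> `|a k| <= p.1.2 * p.2 ^+ k].
Proof.
move=> /andP[l0 l1] alpha1 aE.
pose V k := (1 - l) * a k.+1 ^+ 2 + l * (a k.+1 - a k) ^+ 2.
(* At [alpha = 1] the Lyapunov function shrinks by exactly [l]; the last term is the
   perturbation. *)
have VE k : V k.+1 =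
    l * V k + l ^+ 2 * (a k.+1 - a k) ^+ 2 * (alpha k.+1 ^+ 2 - 1).
  by rewrite /V aE; ring.
have V_ge k : (1 - l) * a k.+1 ^+ 2 <= V k.
  by rewrite lerDl mulr_ge0 ?sqr_ge0.
(* Any rate strictly between [l] and [1] would do: the gap absorbs the perturbation for large [k].
   Also [r > 0] even for [l = 0], which permits division by its powers. *)
pose r := (1 + l) / 2.
have r0 : 0 < r by rewrite /r; lra.
have lr : l < r by rewrite /r; lra.
have r1 : r < 1 by rewrite /r; lra.
have [K _ KP] : \forall k \near \oo, l * alpha k ^+ 2 <= r.
  have : l * alpha k ^+ 2 @[k --> \oo] --> l * 1 ^+ 2.
    by apply: cvgMr; rewrite expr2; exact: cvgM.
  rewrite expr1n mulr1 => lim_l; near=> k.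
  by apply: ltW; near: k; exact: (cvgr_lt _ lim_l).
have V_step k : (K <= k)%N -> V k.+1 <= r * V k.
  move=> Kk; have := KP k.+1 (leqW Kk).
  rewrite VE /V; set A := a k.+1; set B := a k => lal.
  rewrite -subr_ge0.
  have -> : r * ((1 - l) * A ^+ 2 + l * (A - B) ^+ 2) -
    (l * ((1 - l) * A ^+ 2 + l * (A - B) ^+ 2) +
      l ^+ 2 * (A - B) ^+ 2 * (alpha k.+1 ^+ 2 - 1)) =
    (r - l) * ((1 - l) * A ^+ 2) +
      l * (A - B) ^+ 2 * (r - l * alpha k.+1 ^+ 2) by ring.
  have [lr' l1'] := (ltW lr, ltW l1).
  by rewrite addr_ge0 // mulr_ge0 ?subr_ge0 // mulr_ge0 ?sqr_ge0 ?subr_ge0.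
pose D := V K / r ^+ K.+1.
have V_bound k : (K <= k)%N -> V k <= D * r ^+ k.+1.
  elim: k => [|k IHk]; rewrite leq_eqVlt => /predU1P[KE|//];
    try by rewrite /D KE divfK ?lexx // expf_neq0 // gt_eqF.
  rewrite ltnS => Kk; rewrite exprS mulrCA; apply: le_trans (V_step _ Kk) _.
  by rewrite ler_pM2l // IHk.
have lp : 0 < 1 - l by lra.
(* [V k] controls the square of [a k.+1], hence the square roots and the shifted threshold. *)
exists (K.+1, Num.sqrt (D / (1 - l)), Num.sqrt r); split => /=.
- exact: sqrtr_ge0.
- by rewrite sqrtr_ge0 /= -[X in _ < X]sqrtr1 ltr_sqrt // ltr01.
- case=> // k /V_bound Vk.
  have D0 : 0 <= D / (1 - l).
    rewrite divr_ge0 ?(ltW lp) // divr_ge0 ?exprn_ge0 ?(ltW r0) //.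
    by apply: le_trans (V_ge K); rewrite mulr_ge0 ?sqr_ge0 ?(ltW lp).
  rewrite -ler_sqr ?nnegrE ?mulr_ge0 ?exprn_ge0 ?sqrtr_ge0 //.
  rewrite real_normK ?num_real // exprMn exprAC !sqr_sqrtr ?(ltW r0) //.
  rewrite mulrAC ler_pdivlMr // mulrC.
  exact: le_trans (V_ge k) Vk.
Unshelve. all: by end_near.
Qed.

(** The l1 norm in eigencoordinates, in which scalar decay bounds simply add up. *)
Lemma is_norm_sum_abs n (T : 'M[R]_n) : T \in unitmx ->
  is_norm (fun x => \sum_i `|(T *m x) i 0|).
Proof.
move=> Tu; split.
- by move=> x; rewrite sumr_ge0.
- move=> x /eqP; rewrite psumr_eq0 // => /allP Tx0.
  rewrite -[x](mulKmx Tu); have -> : T *m x = 0; last by rewrite mulmx0.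
  apply/colP => i; rewrite [RHS]mxE; apply/eqP; rewrite -normr_eq0.
  exact: Tx0 (mem_index_enum i).
- move=> a x; rewrite mulr_sumr; apply: eq_bigr => i _.
  by rewrite -scalemxAr mxE normrM.
- move=> x y; rewrite -big_split; apply: ler_sum => i _.
  by rewrite mulmxDr mxE ler_normD.
Qed.

Lemma momentum_iteration_converges_linearly n (T P : 'M[R]_n) (d : 'rV[R]_n)
    (q : 'cV[R]_n) alpha (z : nat -> 'cV[R]_n) :
    alpha k @[k --> \oo] --> (1 : R) ->
    T \in unitmx -> (forall i, 0 <= d 0 i < 1) ->
    P = invmx T *m diag_mx d *m T ->
    (forall k, z k.+2 = P *m (z k.+1 + alpha k.+1 *: (z k.+1 - z k)) + q) ->
  exists zstar, converges_linearly z zstar.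
Proof.
move=> alpha1 Tu d01 PE zE.
have TP : T *m P = diag_mx d *m T by rewrite PE !mulmxA mulmxV // mul1mx.
(* The solution of [(I - P) z = q], computed in eigencoordinates, where [1 - d_i > 0]. *)
pose zstar := invmx T *m (\col_i ((T *m q) i 0 / (1 - d 0 i))).
have zstarE : zstar = P *m zstar + q.
  have Tz : T *m zstar = \col_i ((T *m q) i 0 / (1 - d 0 i)).
    by rewrite /zstar mulKVmx.
  apply: (can_inj (mulKmx Tu)); rewrite mulmxDr (mulmxA T P) TP -mulmxA Tz.
  apply/colP => i; move: (T *m q) => Tq.
  rewrite mul_diag_mx !mxE; have /andP[_ di] := d01 i.
  by field; rewrite subr_eq0 gt_eqF.
exists zstar.
pose a i k := (T *m (z k - zstar)) i 0.
have aE i k : a i k.+2 = d 0 i * (a i k.+1 + alpha k.+1 * (a i k.+1 - a i k)).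
  have E : z k.+2 - zstar = P *m ((z k.+1 - zstar) +
      alpha k.+1 *: ((z k.+1 - zstar) - (z k - zstar))).
    rewrite zE {1}zstarE opprD addrACA subrr addr0 -mulmxBr; congr (_ *m _).
    have -> : z k.+1 - zstar - (z k - zstar) = z k.+1 - z k.
      by rewrite opprB addrA subrK.
    by rewrite addrAC.
  rewrite /a E mulmxA TP -mulmxA mul_diag_mx mxE; congr (_ * _).
  rewrite mulmxDr -scalemxAr [T *m (_ - _ - _)]mulmxBr.
  by move: (T *m _) (T *m _) => u v; rewrite !mxE.
(* Packing threshold, constant and rate into one triple lets a single choice select all three for
   each coordinate. *)
have /choice [p pP] := fun i => momentum_recurrence_decay (d01 i) alpha1 (aE i).
pose beta := \big[Order.max/0]_i (p i).2.
have beta_ge i : (p i).2 <= beta by exact: le_bigmax.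
have C0 : 0 <= \sum_i (p i).1.2 by rewrite sumr_ge0 // => i _; case: (pP i).
have beta0 : 0 <= beta by exact: bigmax_ge_id.
(* The sum of the thresholds dominates each of them. The successor and the summand [1] ensure
   [1 <= K] and [0 < C], even for [n = 0]. *)
exists (fun x => \sum_i `|(T *m x) i 0|), (\sum_i (p i).1.1).+1,
  (1 + \sum_i (p i).1.2), beta; split => //.
- exact: is_norm_sum_abs.
- by rewrite ltr_wpDr.
- by rewrite beta0 bigmax_lt // => i _; case: (pP i) => _ /andP[].
move=> k Kk; rewrite mulrDl mul1r ler_wpDl ?exprn_ge0 // mulr_suml.
apply: ler_sum => i _; have [Ci /andP[bi _] ai] := pP i.
apply: le_trans (ai k _) _.
  by apply: leq_trans (ltnW Kk); rewrite (bigD1 i) //= leq_addr.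
by rewrite ler_wpM2l // lerXn2r.
Qed.
End Recurrence.

(** * Gradient and proximal operator of the least-squares loss *)

Section LeastSquares.
Context {R : realType} {m n : nat}.
Implicit Types (A : 'M[R]_(m, n)) (b : 'cV[R]_m) (x v : 'cV[R]_n).

Lemma norm2_sqr k (x : 'cV[R]_k) : norm2 x ^+ 2 = dot x x.
Proof.
rewrite /norm2 sqr_sqrtr; last by rewrite sumr_ge0 // => i _; rewrite sqr_ge0.
by rewrite dotE; under eq_bigr => i _ do rewrite expr2.
Qed.

(** Exact Taylor expansion of a quadratic; both the gradient and the proximal point are read off
    from it. *)
Lemma least_squaresD A b x h : least_squares A b (x + h) = least_squares A b x
  + dot h (A^T *m (A *m x - b)) + 2^-1 * dot (A *m h) (A *m h).
Proof.
rewrite /least_squares !norm2_sqr -dot_mulmxl.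
have -> : A *m (x + h) - b = (A *m x - b) + A *m h by rewrite mulmxDr addrAC.
move: (A *m x - b) (A *m h) => r s.
by rewrite !dot_linear (dotC r s); field.
Qed.

Lemma gradient_least_squares A b x :
  gradient (least_squares A b) x = A^T *m (A *m x - b).
Proof.
apply/colP => i; rewrite [LHS]mxE; set v : 'cV[R]_n := delta_mx i 0.
set g := A^T *m _; pose c := 2^-1 * dot (A *m v) (A *m v).
have -> : g i 0 = dot v g by rewrite /dot /v trmx_delta -rowE [RHS]mxE.
apply/cvg_lim => //.
(* By the expansion, the difference quotient along [v] equals this affine function of [h] away from
   [h = 0]. *)
have : dot v g + h * c @[h --> 0^'] --> dot v g + 0 * c.
  apply: cvgD; first exact: cvg_cst.
  by apply: cvgMl; exact: cvg_within.
rewrite mul0r addr0; apply: cvg_trans; apply: near_eq_cvg.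
near=> h; have h0 : h != 0 by near: h; exact: nbhs_dnbhs_neq.
rewrite /= /shift /= [h *: v + x]addrC least_squaresD -/g -scalemxAr.
rewrite !dot_linear /c.
by rewrite [_ *: _]mulrC; field.
Unshelve. all: by end_near.
Qed.

(** The Hessian of the objective that defines [prox mu (least_squares A b)]. *)
Definition regularized_gram (mu : R) A : 'M[R]_n := 1%:M + mu *: (A^T *m A).

Lemma regularized_gram_sym mu A :
  (regularized_gram mu A)^T = regularized_gram mu A.
Proof. by rewrite linearD linearZ /= trmx1 trmx_mul trmxK. Qed.

Lemma regularized_gramE mu A x :
  regularized_gram mu A *m x = x + mu *: (A^T *m (A *m x)).
Proof. by rewrite mulmxDl mul1mx -scalemxAl -mulmxA. Qed.

Lemma dot_regularized_gram mu A x :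
  dot x (regularized_gram mu A *m x) = dot x x + mu * dot (A *m x) (A *m x).
Proof. by rewrite regularized_gramE !dot_linear -dot_mulmxl. Qed.

Lemma regularized_gram_unit mu A : 0 <= mu -> regularized_gram mu A \in unitmx.
Proof.
move=> mu0; rewrite -unitmx_tr -row_free_unit -kermx_eq0; apply/rowV0P => u.
move=> /sub_kermxP /(congr1 trmx); rewrite trmx_mul trmxK trmx0 => Nu.
apply/eqP; rewrite -trmx_eq0 -dotxx_eq0 eq_le dotxx_ge0 andbT.
have := dot_regularized_gram mu A u^T; rewrite Nu {1}/dot mulmx0 mxE => ->.
by rewrite lerDl mulr_ge0 ?dotxx_ge0.
Qed.

Lemma prox_least_squares mu A b v : 0 <= mu ->
  prox mu (least_squares A b) v =
  invmx (regularized_gram mu A) *m (v + mu *: (A^T *m b)).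
Proof.
move=> mu0; set N := regularized_gram mu A.
have Nu := regularized_gram_unit A mu0.
set x0 := invmx N *m _.
have Nx0 : N *m x0 = v + mu *: (A^T *m b) by rewrite mulKVmx.
pose phi x := 2^-1 * norm2 (x - v) ^+ 2 + mu * least_squares A b x.
(* [x0] is the critical point, so the linear term vanishes. Positivity of the remaining quadratic
   term gives both minimality and the uniqueness that determines the value of [xget]. *)
have phiD h : phi (x0 + h) = phi x0 + 2^-1 * dot h (N *m h).
  have crit : (x0 - v) + mu *: (A^T *m (A *m x0 - b)) = 0.
    move: Nx0; rewrite regularized_gramE mulmxBr scalerBr => /eqP.
    by rewrite -subr_eq0 opprD addrACA => /eqP.
  rewrite /phi least_squaresD dot_regularized_gram addrAC !norm2_sqr.
  have : dot h (x0 - v) + mu * dot h (A^T *m (A *m x0 - b)) = 0.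
    by rewrite -dotZr -dotDr crit /dot mulmx0 mxE.
  move: (x0 - v) (dot h (A^T *m _)) => r t /eqP.
  rewrite addr_eq0 => /eqP hr.
  by rewrite !dot_linear (dotC r h) hr; field.
have h0 h : phi (x0 + h) <= phi x0 -> h = 0.
  rewrite phiD gerDl pmulr_rle0 ?invr_gt0 // dot_regularized_gram => hh.
  apply/eqP; rewrite -dotxx_eq0 eq_le dotxx_ge0 andbT; apply: le_trans hh.
  by rewrite lerDl mulr_ge0 ?dotxx_ge0.
have x0min : argmin phi x0.
  move=> z; rewrite -[z](subrK x0) addrC phiD lerDl mulr_ge0 ?invr_ge0 //.
  by rewrite dot_regularized_gram addr_ge0 ?mulr_ge0 ?dotxx_ge0.
apply: xget_unique => // z zmin; apply/eqP; rewrite -subr_eq0; apply/eqP/h0.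
by rewrite addrC subrK; exact: zmin.
Qed.
End LeastSquares.

(** * The largest eigenvalue as a bound on the spectrum *)

Section Main.
Context {R : realType}.

Lemma le_lambda_max n (S : 'M[R]_n) a : S^T = S -> eigenvalue S a ->
  a <= lambda_max S.
Proof.
move=> Ssym Sa; apply: ub_le_sup => //=.
have [Q [d [QQ SE]]] := symmetric_spectral Ssym.
(* The supremum bounds its members once the spectrum has some upper bound. Every eigenvalue is a
   diagonal entry: look at a nonzero coordinate of its eigenvector in the basis [Q]. *)
exists (\big[Order.max/0]_i d 0 i) => c /eigenvalueP [v vS v0].
have wD : v *m Q^T *m diag_mx d = c *: (v *m Q^T).
  by rewrite scalemxAl -vS SE -!mulmxA QQ mulmx1.
have w0 : v *m Q^T != 0.
  apply: contra_neq v0 => w0.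
  by rewrite -[v]mulmx1 -(mulmx1C QQ) mulmxA w0 mul0mx.
have /rV0Pn [i wi] := w0.
suff <- : d 0 i = c by exact: le_bigmax.
apply: (mulfI wi); have /rowP/(_ i) := wD.
by rewrite mul_mx_diag mxE => ->; rewrite [LHS]mxE mulrC.
Qed.

(** * Convex combinations of the denoiser with the identity *)

Section Relaxation.
Context {n : nat}.
Implicit Types (W : 'M[R]_n) (t : R) (x : 'cV[R]_n).

Definition relaxation t W : 'M[R]_n := t *: W + (1 - t) *: 1%:M.

Lemma relaxationE t W x :
  relaxation t W *m x = t *: (W *m x) + (1 - t) *: x.
Proof. by rewrite mulmxDl -!scalemxAl mul1mx. Qed.

Lemma relaxation_sym t W : W^T = W -> (relaxation t W)^T = relaxation t W.
Proof. by move=> W_sym; rewrite linearD !linearZ /= trmx1 W_sym. Qed.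

Lemma dot_relaxation t W x : 0 <= t <= 1 ->
  0 <= dot x (W *m x) <= dot x x ->
  0 <= dot x (relaxation t W *m x) <= dot x x.
Proof.
move=> /andP[t0 t1] /andP[W0 W1]; rewrite relaxationE !dot_linear.
apply/andP; split; first by rewrite addr_ge0 ?mulr_ge0 ?subr_ge0 ?dotxx_ge0.
by rewrite mulrBl mul1r addrCA gerDl subr_le0 ler_wpM2l.
Qed.

Lemma relaxation_fix t W x : t != 0 -> relaxation t W *m x = x -> W *m x = x.
Proof.
move=> t0 /eqP; rewrite relaxationE scalerBl scale1r addrCA.
rewrite -[X in _ == X]addr0 (inj_eq (addrI x)) -scalerBr scaler_eq0.
by rewrite (negPf t0) subr_eq0 => /eqP.
Qed.
End Relaxation.

(** * The two algorithms as momentum iterations *)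

Section Problem.
Variables (m n : nat) (A : 'M[R]_(m, n)) (b : 'cV[R]_m) (W : 'M[R]_n).
Variable alpha : nat -> R.
Hypotheses (W_sym : W^T = W) (W_spec : spectrum W `<=` [set a | 0 <= a <= 1]).
Hypothesis ker_fix : null_space A `&` fix_space W = [set 0].
Hypothesis alpha_cvg : alpha k @[k --> \oo] --> (1 : R).

Let W01 x : 0 <= dot x (W *m x) <= dot x x.
Proof.
apply/andP; split.
  by apply: dot_ge0_of_eigenvalue_ge0 => // a /W_spec /andP[].
rewrite -[leRHS]mul1r; apply: dot_le_of_eigenvalue_le => // a.
by move=> /W_spec /andP[].
Qed.

Let AA_sym : (A^T *m A)^T = A^T *m A.
Proof. by rewrite trmx_mul trmxK. Qed.

Let ker_fix0 (x : 'cV[R]_n) : W *m x = x -> A^T *m (A *m x) = 0 -> x = 0.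
Proof.
move=> Wx /mul_tr_mx_eq0 Ax.
have : (null_space A `&` fix_space W) x by split.
by rewrite ker_fix.
Qed.

(** The step-size bound makes [I - gamma A^T A] positive definite, and its fixed vectors are those
    killed by [A^T A]. *)
Lemma pnp_fista_global_linear_convergence gamma :
  0 < gamma -> (gamma%:E < 1 / (lambda_max (A^T *m A))%:E)%E ->
  global_linear_convergence (pnp_fista (least_squares A b) W gamma alpha).
Proof.
move=> gamma0 gammaE x0.
have gamma_lt1 : gamma * lambda_max (A^T *m A) < 1.
  (* The extended inverse is a real number only away from [0]; for a nonpositive [lambda_max] the
     product is at most [0] anyway. *)
  have [l0|l0] := leP (lambda_max (A^T *m A)) 0.
    by apply: le_lt_trans ltr01; rewrite mulr_ge0_le0 // ltW.
  by move: gammaE; rewrite mul1e inver gt_eqF // lte_fin -ltr_pdivlMr ?mul1r.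
pose G : 'M[R]_n := 1%:M - gamma *: (A^T *m A).
have GE (x : 'cV[R]_n) : G *m x = x - gamma *: (A^T *m (A *m x)).
  by rewrite mulmxBl mul1mx -scalemxAl -mulmxA.
have Gsym : G^T = G by rewrite linearB linearZ /= trmx1 AA_sym.
have G01 x : x != 0 -> 0 < dot x (G *m x) <= dot x x.
  move=> /dotxx_gt0 x_gt0; rewrite GE !dot_linear -dot_mulmxl.
  rewrite gerBl mulr_ge0 ?dotxx_ge0 ?ltW // andbT subr_gt0.
  have Ax : dot (A *m x) (A *m x) <= lambda_max (A^T *m A) * dot x x.
    rewrite dot_mulmxl mulmxA; apply: dot_le_of_eigenvalue_le => // a.
    exact: le_lambda_max.
  apply: (@le_lt_trans _ _ (gamma * (lambda_max (A^T *m A) * dot x x))).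
    by rewrite ler_pM2l.
  by rewrite mulrA gtr_pMl.
have [|T [d [Tu d01 WG]]] := mulmx_diagonalizable W_sym W01 Gsym G01.
  move=> x Wx Gx; apply: ker_fix0 => //; apply/eqP.
  have /eqP := GE x; rewrite Gx -subr_eq0 opprB addrCA subrr addr0.
  by rewrite scaler_eq0 gt_eqF.
set z := pnp_fista _ _ _ _ _.
(* Eliminates [y] from the state, leaving a two-step recurrence in the iterates alone. *)
have stateE k : pnp_fista_state (least_squares A b) W gamma alpha x0 k.+1 =
    (z k.+1, z k.+1 + alpha k.+1 *: (z k.+1 - z k)).
  by rewrite /z /pnp_fista /=; case: (pnp_fista_state _ _ _ _ _ k).
apply: (momentum_iteration_converges_linearly
  (q := gamma *: (W *m (A^T *m b))) alpha_cvg Tu d01 WG) => k.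
have -> : z k.+2 = (let: (xj, yk) := pnp_fista_state (least_squares A b) W
    gamma alpha x0 k.+1 in
    W *m (yk - gamma *: gradient (least_squares A b) yk)).
  by rewrite /z /pnp_fista /=; case: (pnp_fista_state _ _ _ _ _ k).
rewrite stateE.
set y := z k.+1 + _; rewrite gradient_least_squares -mulmxA GE.
by rewrite [A^T *m _]mulmxBr scalerBr opprB addrA addrAC mulmxDr -scalemxAr.
Qed.

(** The proximal map is affine with linear part [invmx N], and [1 <= L] makes [V] a convex
    combination of [W] and the identity. *)
Lemma red_apg_global_linear_convergence L lambda : 1 <= L -> 0 < lambda ->
  global_linear_convergence (red_apg (least_squares A b) W lambda L alpha).
Proof.
move=> L1 lambda0 init; set mu := (lambda * L)^-1; set theta := 1 / L.
have L0 : 0 < L by apply: lt_le_trans L1.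
have mu0 : 0 < mu by rewrite invr_gt0 mulr_gt0.
have theta0 : 0 < theta by rewrite divr_gt0.
have theta1 : theta <= 1 by rewrite ler_pdivrMr ?mul1r.
set N := regularized_gram mu A; have Nu := regularized_gram_unit A (ltW mu0).
set V := relaxation theta W.
have Vsym : V^T = V by exact: relaxation_sym.
have V01 x : 0 <= dot x (V *m x) <= dot x x.
  by apply: dot_relaxation; rewrite ?(ltW theta0).
have Gsym : (invmx N)^T = invmx N by rewrite trmx_inv /N regularized_gram_sym.
have NG (x : 'cV[R]_n) : N *m (invmx N *m x) = x by rewrite mulKVmx.
have G01 x : x != 0 -> 0 < dot x (invmx N *m x) <= dot x x.
  move=> x0; have := NG x; set g := invmx N *m x => Ng.
  have g0 : g != 0 by apply: contra_neq x0 => g0; rewrite -Ng g0 mulmx0.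
  have Agg := dotxx_ge0 (A *m g); have AAgg := dotxx_ge0 (A^T *m (A *m g)).
  have gg := dotxx_gt0 g0.
  (* With [x = N g], the form is [|g|^2 + mu |A g|^2], while [|x|^2 = |g|^2 + 2 mu |A g|^2 + mu^2
     |A^T A g|^2]. *)
  rewrite -Ng regularized_gramE !dot_linear [dot (A^T *m _) g]dotC -dot_mulmxl.
  set u := dot (A *m g) _ in Agg *; set w := dot (A^T *m _) _ in AAgg *.
  have h1 : 0 <= mu * u by rewrite mulr_ge0 // ltW.
  have h2 : 0 <= mu * (mu * w) by rewrite !mulr_ge0 // ltW.
  by apply/andP; split; lra.
have [|T [d [Tu d01 VG]]] := mulmx_diagonalizable Vsym V01 Gsym G01.
  move=> x Vx Gx; apply: ker_fix0.
    by apply: relaxation_fix Vx; rewrite gt_eqF.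
  have := NG x; rewrite Gx regularized_gramE => /eqP.
  by rewrite -subr_eq0 addrC addKr scaler_eq0 gt_eqF // => /eqP.
(* Here the denoiser acts before the proximal map, so the factors come in the opposite order;
   transposing the diagonalization of [V *m invmx N] corrects this. *)
have GV : invmx N *m V = invmx (invmx T^T) *m diag_mx d *m invmx T^T.
  rewrite -[LHS]trmxK trmx_mul Vsym Gsym VG !trmx_mul tr_diag_mx invmxK.
  by rewrite trmx_inv mulmxA.
set z := red_apg _ _ _ _ _ _.
have stateE k : red_apg_state (least_squares A b) W lambda L alpha init k.+1 =
    (z k.+1, V *m (z k.+1 + alpha k.+1 *: (z k.+1 - z k))).
  rewrite relaxationE /z /red_apg /=.
  by case: (red_apg_state _ _ _ _ _ _ k).
apply: (momentum_iteration_converges_linearly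
  (q := mu *: (invmx N *m (A^T *m b))) alpha_cvg _ d01 GV) => [|k].
  by rewrite unitmx_inv unitmx_tr.
have -> : z k.+2 = prox mu (least_squares A b)
    (red_apg_state (least_squares A b) W lambda L alpha init k.+1).2.
  by rewrite /z /red_apg /=; case: (red_apg_state _ _ _ _ _ _ k).
rewrite stateE /=.
by rewrite prox_least_squares ?(ltW mu0) // -/N mulmxDr -scalemxAr mulmxA.
Qed.
End Problem.
End Main.

(* The extended-real inverse makes the step-size bound 1 / lambda_max equal to
   +oo when lambda_max = 0. *)
Theorem theorem3p5 (R : realType) (m n : nat)
    (A : 'M[R]_(m, n)) (b : 'cV[R]_m) (W : 'M[R]_n) (alpha : nat -> R)
    (W_sym : W^T = W)
    (W_spec : spectrum W `<=` [set a | 0 <= a <= 1])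
    (ker_fix : null_space A `&` fix_space W = [set 0])
    (alpha_cvg : alpha k @[k --> \oo] --> (1 : R)) :
  (forall gamma : R,
     0 < gamma -> (gamma%:E < 1 / (lambda_max (A^T *m A))%:E)%E ->
     global_linear_convergence
       (pnp_fista (least_squares A b) W gamma alpha)) /\
  (forall L lambda : R, 1 <= L -> 0 < lambda ->
     global_linear_convergence
       (red_apg (least_squares A b) W lambda L alpha)).
Proof.
split=> [gamma gamma0 gammaE|L lambda L1 lambda0].
  exact: pnp_fista_global_linear_convergence.
exact: red_apg_global_linear_convergence.
Qed.
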